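(* Let $V$ be a finite token set, $P$ a probability distribution on $V$, and $V=R\sqcup G$ the true partition into red list $R$ and green list $G$, with watermark strength $\delta>0$. Let $V=\hat R\sqcup\hat G$ be an estimated partition into red and green lists and $\hat\delta>0$ an estimated watermark strength. Let $P_W$ be the watermarked distribution obtained from $P$ using $(R,G,\delta)$, and let $P_R$ be the distribution after watermark removal obtained from $P_W$ using $(\hat R,\hat G,\hat\delta)$ with removal strength $\eta=1$. Let $0\le\epsilon_1<1$ and $\epsilon_2\ge 0$. If $$\sum_{t\in\hat R,\,t\in G}P(t)+\sum_{t\in\hat G,\,t\in R}P(t)\le\epsilon_1\quad\text{and}\quad|\delta-\hat\delta|\le\epsilon_2,$$ then $$\mathbb{TV}(P_R,P)\le \epsilon_1 f_2(\epsilon_1,\epsilon_2)+(1-\epsilon_1)f_1(\epsilon_1,\epsilon_2),$$ where $\mathbb{TV}(P,Q):=\sum_{t}|P(t)-Q(t)|$, $$f_1(\epsilon_1,\epsilon_2):=\max\left\{\frac{e^{2\epsilon_2}}{1-\epsilon_1}-1,\;1-\frac{e^{-2\epsilon_2}}{(1-\epsilon_1)+\epsilon_1e^{\delta-\epsilon_2}}\right\}$$ and $$f_2(\epsilon_1,\epsilon_2):=\max\left\{\frac{e^{\delta+2\epsilon_2}}{1-\epsilon_1}-1,\;1-\frac{e^{-\delta-2\epsilon_2}}{(1-\epsilon_1)+\epsilon_1e^{\delta-\epsilon_2}}\right\}.$$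
   Context: n-gram watermarking (for a fixed context): the watermarked distribution obtained from $P$ with red list $R$, green list $G$ and strength $\delta$ is $$P_W(t)=\begin{cases}\dfrac{P(t)}{\sum_{t'\in R}P(t')+\sum_{t'\in G}e^{\delta}P(t')}, & t\in R,\\[2ex] \dfrac{e^{\delta}P(t)}{\sum_{t'\in R}P(t')+\sum_{t'\in G}e^{\delta}P(t')}, & t\in G.\end{cases}$$ Watermark removal: given estimates $\hat R,\hat G,\hat\delta$ and removal strength $\eta$, the distribution after removal is $$P_R(t)=\begin{cases}\dfrac{P_W(t)}{\sum_{t'\in\hat R}P_W(t')+\sum_{t'\in\hat G}e^{-\eta\hat\delta}P_W(t')}, & t\in\hat R,\\[2ex] \dfrac{e^{-\eta\hat\delta}P_W(t)}{\sum_{t'\in\hat R}P_W(t')+\sum_{t'\in\hat G}e^{-\eta\hat\delta}P_W(t')}, & t\in\hat G.\end{cases}$$ The subscript $R$ in $P_R$ stands for ''removal'' and does not refer to the red list. Note that $\mathbb{TV}$ is defined without the factor $\tfrac12$. *)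

(* Defs.v *)
From mathcomp Require Import all_boot all_order all_algebra.
From mathcomp Require Import reals sequences exp.

Set Implicit Arguments.
Unset Strict Implicit.
Unset Printing Implicit Defensive.

Import Order.TTheory GRing.Theory Num.Theory.
Local Open Scope ring_scope.

Definition is_distribution (K : realType) (V : finType) (P : V -> K) : Prop :=
  (forall t, 0 <= P t) /\ \sum_t P t = 1.

(* Unlike [finset.partition], this allows either list to be empty. *)
Definition red_green_split (V : finType) (red green : {set V}) : Prop :=
  red :|: green = [set: V] /\ [disjoint red & green].

(* [red] and [green] are meant to satisfy [red_green_split], so that the
   [else] branches below, and in [removed], are exactly the green tokens. *)
Definition watermarked (K : realType) (V : finType) (red green : {set V})
    (delta : K) (P : V -> K) (t : V) : K :=
  let Z := \sum_(t' in red) P t' + \sum_(t' in green) expR delta * P t' in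
  if t \in red then P t / Z else expR delta * P t / Z.

Definition removed (K : realType) (V : finType) (red green : {set V})
    (delta eta : K) (PW : V -> K) (t : V) : K :=
  let Z := \sum_(t' in red) PW t'
           + \sum_(t' in green) expR (- eta * delta) * PW t' in
  if t \in red then PW t / Z else expR (- eta * delta) * PW t / Z.

(* The total variation distance without the factor 1/2. *)
Definition TV (K : realType) (V : finType) (P Q : V -> K) : K :=
  \sum_t `|P t - Q t|.

(* The bounds depend on the true strength [delta] as well. *)
Definition f1 (K : realType) (delta eps1 eps2 : K) : K :=
  Num.max (expR (2 * eps2) / (1 - eps1) - 1)
          (1 - expR (- 2 * eps2)
               / ((1 - eps1) + eps1 * expR (delta - eps2))).

Definition f2 (K : realType) (delta eps1 eps2 : K) : K :=
  Num.max (expR (delta + 2 * eps2) / (1 - eps1) - 1)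
          (1 - expR (- delta - 2 * eps2)
               / ((1 - eps1) + eps1 * expR (delta - eps2))).

(* Main.v *)
Require Import Defs.
From mathcomp Require Import all_boot all_order all_algebra.
From mathcomp Require Import reals sequences exp.
From mathcomp Require Import ring lra.

Import Order.TTheory GRing.Theory Num.Theory.
Local Open Scope ring_scope.

(** Watermarking followed by removal reweights [P] by a factor [w] and
    normalizes by [D = \sum_t P t * w t].  On correctly classified tokens [w]
    is [1] or [e^(delta - delta_hat)], hence within [e^(+-eps2)]; on
    misclassified ones, of total mass at most [eps1], it is [e^delta] or
    [e^(-delta_hat)].  Averaging gives
    [(1 - eps1) e^(-eps2) <= D <= (1 - eps1) e^eps2 + eps1 e^delta],
    so [|w / D - 1|] is at most [f1] on the former tokens and [f2] on the
    latter, and averaging again gives the bound. *)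

Lemma split_greenE (V : finType) (red green : {set V}) (t : V) :
  red_green_split red green -> (t \in green) = (t \notin red).
Proof.
move=> [cover disj]; have := in_setT t; rewrite -cover inE.
by have := disjointFr disj (x := t); case: (t \in red) => /= [->|].
Qed.

Lemma sum_red_green (K : realType) (V : finType) (red green : {set V})
    (F G : V -> K) : red_green_split red green ->
  \sum_(t in red) F t + \sum_(t in green) G t
    = \sum_t (if t \in red then F t else G t).
Proof.
move=> split_V; rewrite [RHS](bigID (mem red)) /=; congr (_ + _).
  by apply: eq_bigr => t ->.
rewrite (eq_bigl _ _ (fun t => split_greenE _ _ _ t split_V)).
by apply: eq_bigr => t /negbTE ->.
Qed.

Definition reweight {K : realType} {V : finType} (red red_hat : {set V})
    (delta delta_hat : K) (t : V) : K :=
  (if t \in red then 1 else expR delta)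
  * (if t \in red_hat then 1 else expR (- delta_hat)).

(** The normalizer [Z] of the watermark divides every value of the watermarked distribution, hence
    also the normalizer [Z'] of the removal, so it cancels from the quotient. *)
Lemma removed_watermarkedE (K : realType) (V : finType) (P : V -> K)
    (red green red_hat green_hat : {set V}) (delta delta_hat : K) (t : V) :
  is_distribution P -> red_green_split red green ->
  red_green_split red_hat green_hat -> 0 < delta ->
  let w := reweight red red_hat delta delta_hat in
  removed red_hat green_hat delta_hat 1 (watermarked red green delta P) t
    = P t * (w t / \sum_t' P t' * w t').
Proof.
move=> [P_ge0 P_sum] split_true split_est delta_gt0 w.
rewrite /removed /watermarked !sum_red_green // mulN1r.
set Z := \sum_t (if t \in red then _ else _).
(* In fact [Z] is at least the total mass [1], since [delta > 0] makes every weight at least [1]. *)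
have Z_gt0 : 0 < Z.
  apply: lt_le_trans ltr01 _; rewrite -P_sum; apply: ler_sum => s _.
  by case: ifP => // _; rewrite ler_peMl // -expR0 ler_expR ltW.
set Z' := \sum_t (if t \in red_hat then _ else _).
have -> : Z' = (\sum_s P s * w s) / Z.
  rewrite mulr_suml; apply: eq_bigr => s _; rewrite /w /reweight.
  by case: ifP => _; case: ifP => _; ring.
rewrite invf_div; set S := \sum_s P s * w s.
have ZV : Z^-1 * (Z / S) = S^-1 by rewrite mulrA mulVf ?mul1r // gt_eqF.
rewrite -[in RHS]ZV /w /reweight.
by case: ifP => _; case: ifP => _; ring.
Qed.

(** The mass of [B] may be less than [eps], but as [g <= h], shifting mass into [B] can only raise
    the bound. *)
Lemma sum_le_mix (K : realType) (V : finType) (P F : V -> K) (B : pred V)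
    (eps g h : K) :
  is_distribution P -> \sum_(t | B t) P t <= eps -> g <= h ->
  (forall t, B t -> F t <= P t * h) -> (forall t, ~~ B t -> F t <= P t * g) ->
  \sum_t F t <= eps * h + (1 - eps) * g.
Proof.
move=> [P_ge0 P_sum] mass gh FB FnB.
have FnB' : \sum_(t | ~~ B t) F t <= (1 - \sum_(t | B t) P t) * g.
  have -> : 1 - \sum_(t | B t) P t = \sum_(t | ~~ B t) P t.
    by rewrite -P_sum [X in X - _](bigID B) /= [LHS]addrC addKr.
  by rewrite mulr_suml ler_sum.
have FB' : \sum_(t | B t) F t <= (\sum_(t | B t) P t) * h.
  by rewrite mulr_suml ler_sum.
rewrite (bigID B) /=; apply: le_trans (lerD FB' FnB') _.
(* With [m] the mass of [B], the slack is [(eps - m) * (h - g)]. *)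
by nra.
Qed.

(** The quotient [w / D] lies between [lo / U] and [hi / L]; the two arms of the maximum bound its
    excess over [1] and its shortfall below [1]. *)
Lemma ratio_dist_le (K : realType) (lo hi L U w D : K) :
  0 < L -> 0 <= lo -> L <= D <= U -> lo <= w <= hi ->
  `|w / D - 1| <= Num.max (hi / L - 1) (1 - lo / U).
Proof.
move=> L_gt0 lo_ge0 /andP[LD DU] /andP[low whi].
have D_gt0 := lt_le_trans L_gt0 LD; have U_gt0 := lt_le_trans D_gt0 DU.
have upper : w / D <= hi / L.
  by apply: ler_pM; rewrite ?invr_ge0 ?lef_pV2 ?(ltW D_gt0) // (le_trans lo_ge0).
have lower : lo / U <= w / D.
  by apply: ler_pM; rewrite ?invr_ge0 ?lef_pV2 ?(ltW U_gt0).
by rewrite ler_norml le_max lerNl le_max; apply/andP; split; lra.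
Qed.

Lemma max_ratio_le (K : realType) (lo lo' hi hi' L U : K) :
  0 < L -> 0 < U -> lo' <= lo -> hi <= hi' ->
  Num.max (hi / L - 1) (1 - lo / U) <= Num.max (hi' / L - 1) (1 - lo' / U).
Proof.
move=> L_gt0 U_gt0 lo_le hi_le; apply: le_max2.
  by rewrite lerD2r ler_pM2r ?invr_gt0.
by rewrite lerD2l lerN2 ler_pM2r ?invr_gt0.
Qed.

(* The bound by [delta] is what keeps the estimate of the normalizing
   constant valid when [delta < eps2]. *)
Lemma reweight_correct (K : realType) (V : finType) (red red_hat : {set V})
    (delta delta_hat eps2 : K) (t : V) :
  0 < delta -> 0 < delta_hat -> `|delta - delta_hat| <= eps2 ->
  (t \in red) = (t \in red_hat) ->
  expR (- eps2) <= reweight red red_hat delta delta_hat t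
    <= expR (Num.min delta eps2).
Proof.
move=> delta_gt0 delta_hat_gt0 err_strength.
have eps2_ge0 := le_trans (normr_ge0 _) err_strength.
move: err_strength; rewrite ler_norml => /andP[lo hi].
rewrite /reweight => ->; case: ifP => _.
  rewrite mulr1 -expR0 !ler_expR le_min oppr_le0 (ltW delta_gt0).
  by rewrite eps2_ge0.
rewrite -expRD !ler_expR le_min lo hi andbT /= lerBlDr lerDl.
exact: ltW.
Qed.

(** A green token taken for red has weight [expR delta]; a red one taken for green has
    [expR (- delta_hat)], where [delta_hat <= delta + eps2]. *)
Lemma reweight_misclassified (K : realType) (V : finType)
    (red red_hat : {set V}) (delta delta_hat eps2 : K) (t : V) :
  0 < delta -> 0 < delta_hat -> `|delta - delta_hat| <= eps2 ->
  (t \in red) != (t \in red_hat) ->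
  expR (- delta - eps2) <= reweight red red_hat delta delta_hat t
    <= expR delta.
Proof.
move=> delta_gt0 delta_hat_gt0; rewrite /reweight ler_norml => /andP[lo hi].
by case: ifP => _; case: ifP => //= _ _; rewrite ?mul1r ?mulr1 !ler_expR;
  apply/andP; split; lra.
Qed.

Theorem theorem4p2 (K : realType) (V : finType) (P : V -> K)
    (red green red_hat green_hat : {set V})
    (delta delta_hat eps1 eps2 : K)
    (P_distr : is_distribution P)
    (split_true : red_green_split red green)
    (split_est : red_green_split red_hat green_hat)
    (delta_gt0 : 0 < delta) (delta_hat_gt0 : 0 < delta_hat)
    (eps1_ge0 : 0 <= eps1) (eps1_lt1 : eps1 < 1) (eps2_ge0 : 0 <= eps2)
    (err_lists : \sum_(t | (t \in red_hat) && (t \in green)) P t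
                 + \sum_(t | (t \in green_hat) && (t \in red)) P t <= eps1)
    (err_strength : `|delta - delta_hat| <= eps2) :
  let PW := watermarked red green delta P in
  let PR := removed red_hat green_hat delta_hat 1 PW in
  TV PR P <= eps1 * f2 delta eps1 eps2 + (1 - eps1) * f1 delta eps1 eps2.
Proof.
lazy zeta; set PR := removed _ _ _ _ _; have [P_ge0 P_sum] := P_distr.
pose B t := (t \in red) != (t \in red_hat).
pose w := reweight red red_hat delta delta_hat.
have mass : \sum_(t | B t) P t <= eps1.
  (* Splitting [B] by membership in [red_hat] gives exactly the two sums of [err_lists]. *)
  apply: le_trans err_lists; rewrite (bigID (mem red_hat)) /= le_eqVlt.
  apply/orP; left; apply/eqP; congr (_ + _); apply: eq_bigl => t;
    rewrite /B (split_greenE _ _ _ t split_true, split_greenE _ _ _ t split_est);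
    by case: (t \in red); case: (t \in red_hat).
have correct t : ~~ B t -> expR (- eps2) <= w t <= expR (Num.min delta eps2).
  by rewrite negbK => /eqP; exact: reweight_correct.
have wrong t : B t -> expR (- delta - eps2) <= w t <= expR delta.
  exact: reweight_misclassified.
set L := (1 - eps1) * expR (- eps2).
set U := (1 - eps1) * expR eps2 + eps1 * expR delta.
have eps1'_gt0 : 0 < 1 - eps1 by rewrite subr_gt0.
have L_gt0 : 0 < L by rewrite mulr_gt0 ?expR_gt0.
have U_gt0 : 0 < U.
  by rewrite ltr_wpDr ?mulr_gt0 ?mulr_ge0 ?expR_gt0 ?expR_ge0.
pose D := \sum_t P t * w t.
have D_bounds : L <= D <= U.
  apply/andP; split.
    (* Negation turns the lower bound into an instance of [sum_le_mix]; misclassified tokens are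
       only bounded below by [0], so [h] is [0]. *)
    rewrite -lerN2 -sumrN.
    have -> : - L = eps1 * 0 + (1 - eps1) * - expR (- eps2) by rewrite /L; ring.
    apply: (sum_le_mix _ _ _ _ B) => // [|t Bt|t nBt].
    - by rewrite oppr_le0 expR_ge0.
    - have /andP[w_ge _] := wrong t Bt.
      by rewrite mulr0 oppr_le0 mulr_ge0 // (le_trans (expR_ge0 _) w_ge).
    - have /andP[w_ge _] := correct t nBt.
      by rewrite mulrN lerN2 ler_wpM2l.
  apply: (@le_trans _ _ (eps1 * expR delta
                         + (1 - eps1) * expR (Num.min delta eps2))).
    apply: (sum_le_mix _ _ _ _ B) => // [|t Bt|t nBt].
    - by rewrite ler_expR ge_min lexx.
    - by have /andP[_ ?] := wrong t Bt; rewrite ler_wpM2l.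
    - by have /andP[_ ?] := correct t nBt; rewrite ler_wpM2l.
  by rewrite addrC lerD2r ler_pM2l // ler_expR ge_min lexx orbT.
(* Pulling [expR eps2] out of [U] leaves the denominator shared by [f1] and [f2]. This factor, and
   [expR (- eps2)] in [L], account for the second [eps2] in their exponents. *)
have ULE : U = expR eps2 * ((1 - eps1) + eps1 * expR (delta - eps2)).
  by rewrite expRD expRN /U; field; rewrite expR_eq0.
have upperE x : expR (x + eps2) / (1 - eps1) = expR x / L.
  rewrite expRD /L expRN; field; rewrite expR_eq0 /=.
  by rewrite gt_eqF.
have lowerE x : expR (x - eps2) / ((1 - eps1) + eps1 * expR (delta - eps2))
    = expR x / U.
  by rewrite ULE (expRD x) (expRN eps2) invfM mulrA.
have f1E : f1 delta eps1 eps2 =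
    Num.max (expR eps2 / L - 1) (1 - expR (- eps2) / U).
  by rewrite /f1 -upperE -lowerE; congr (Num.max (expR _ / _ - 1)
    (1 - expR _ / _)); ring.
have f2E : f2 delta eps1 eps2 =
    Num.max (expR (delta + eps2) / L - 1) (1 - expR (- delta - eps2) / U).
  by rewrite /f2 -upperE -lowerE; congr (Num.max (expR _ / _ - 1)
    (1 - expR _ / _)); ring.
have PR_dist t : `|PR t - P t| = P t * `|w t / D - 1|.
  rewrite /PR removed_watermarkedE //= -/w -/D.
  by rewrite -{2}[P t]mulr1 -mulrBr normrM ger0_norm.
apply: (sum_le_mix _ _ _ _ B) => // [|t Bt|t nBt].
(* Here [f1 <= f2], because [f2] comes from a wider interval of weights over the same [L] and
   [U]. *)
- by rewrite f1E f2E max_ratio_le // ler_expR; lra.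
- rewrite PR_dist ler_wpM2l // f2E ratio_dist_le ?expR_ge0 //.
  have /andP[-> w_le] := wrong t Bt; apply: le_trans w_le _.
  by rewrite ler_expR; lra.
- rewrite PR_dist ler_wpM2l // f1E ratio_dist_le ?expR_ge0 //.
  have /andP[-> w_le] := correct t nBt; apply: le_trans w_le _.
  by rewrite ler_expR ge_min lexx orbT.
Qed.
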